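(* Let $X$ be well ordered, $\Omega=\{P\}$, $\lambda\in K$, $\mathfrak{S}(X)$ ordered by order $(1)$, and $S=\{P(x)P(y)-P(P(x)y)-P(xP(y))-\lambda P(xy)\mid x,y\in\mathfrak{S}(X)\}$. Then $Irr(S)=\Phi(X)$, and $\Phi(X)$ is a $K$-basis of $K\langle X;P|S\rangle=K\langle X;P\rangle/Id(S)$.
   Context: $K$ is a commutative ring with unit. $S(Y)$ denotes the free semigroup on $Y$. $\mathfrak{S}(X)$ is the set of $\Omega$-words for $\Omega=\{P\}$ unary: $\mathfrak{S}_0=S(X)$, $\mathfrak{S}_n=S(X\cup\{P(u)\mid u\in\mathfrak{S}_{n-1}\})$, $\mathfrak{S}(X)=\bigcup_n\mathfrak{S}_n$. $K\langle X;P\rangle$ is the free $K$-module on $\mathfrak{S}(X)$ with concatenation product and $P$ extended linearly. $\mathfrak{S}^\star(X)$ is the set of $\Omega$-words on $X\cup\{\star\}$ with exactly one $\star$, $u|_s$ the substitution of $s$ for $\star$. $Id(S)$ is the $K$-span of all $u|_s$, $u\in\mathfrak{S}^\star(X)$, $s\in S$. $\bar f$ is the leading word of $f$ w.r.t. the given order, and $Irr(S)=\{w\in\mathfrak{S}(X)\mid w\ne u|_{\bar s}\text{ for all }u\in\mathfrak{S}^\star(X),s\in S\}$. Order (1): with $X^*$ ordered deg-lex, write $u=u_0P(x_1)u_1\cdots P(x_t)u_t$ uniquely ($u_i\in X^*$, $x_k\in\mathfrak{S}(X)$), $wt(u)=(t,P,x_1,\dots,P,x_t,u_0,\dots,u_t)$,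 and $u>v$ iff $wt(u)>wt(v)$ lexicographically (recursively on depth). Rota–Baxter words: for $Y,Z\subseteq\mathfrak{S}(X)$ let $YP(Z)=\{yP(z)\}$ etc. and $\Lambda^P_X(Y,Z)=\bigcup_{r\ge1}(YP(Z))^r\cup\bigcup_{r\ge0}(YP(Z))^rY\cup\bigcup_{r\ge1}(P(Z)Y)^r\cup\bigcup_{r\ge0}(P(Z)Y)^rP(Z)$. Put $\Phi_0=S(X)$, $\Phi_n=\Lambda^P_X(\Phi_0,\Phi_{n-1})$ for $n>0$, and $\Phi(X)=\bigcup_{n\ge0}\Phi_n$. *)

(* Defs.v *)
From HB Require Import structures.
From mathcomp Require Import all_boot all_order all_algebra.
Set Implicit Arguments. Unset Strict Implicit. Unset Printing Implicit Defensive.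
Import Order.TTheory GRing.Theory.

(* Omega-words for Omega = {P} unary, over an alphabet A.              *)
(* A word is a nonempty sequence of letters; a letter is either a      *)
(* generator a : A or P(w) for a word w.  word A = \frak S(A).         *)
Inductive word (A : Type) : Type :=
| wsing : letter A -> word A
| wcons : letter A -> word A -> word A
with letter (A : Type) : Type :=
| LX : A -> letter A
| LP : word A -> letter A.

Arguments wsing {A} l.
Arguments wcons {A} l w.
Arguments LX {A} a.
Arguments LP {A} w.

Scheme word_mut := Induction for word Sort Prop
  with letter_mut := Induction for letter Sort Prop.

Section WordBasics.
Variable A : Type.

Fixpoint wcat (u v : word A) : word A :=
  match u with
  | wsing l => wcons l v
  | wcons l u' => wcons l (wcat u' v)
  end.

Fixpoint letters (u : word A) : seq (letter A) :=
  match u with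
  | wsing l => [:: l]
  | wcons l u' => l :: letters u'
  end.

Fixpoint wsize (u : word A) : nat :=
  match u with
  | wsing l => lsize l
  | wcons l u' => lsize l + wsize u'
  end
with lsize (l : letter A) : nat :=
  match l with
  | LX _ => 1
  | LP w => (wsize w).+1
  end.

Definition pw (z : word A) : word A := wsing (LP z).

End WordBasics.

Section WordEq.
Variable A : eqType.

Fixpoint weqb (u v : word A) : bool :=
  match u, v with
  | wsing l, wsing l' => leqb l l'
  | wcons l u', wcons l' v' => leqb l l' && weqb u' v'
  | _, _ => false
  end
with leqb (l l' : letter A) : bool :=
  match l, l' with
  | LX a, LX b => a == b
  | LP u, LP v => weqb u v
  | _, _ => false
  end.

Lemma weqb_iff : forall u v, weqb u v <-> u = v.
Proof.
apply: (@word_mut A (fun u => forall v, weqb u v <-> u = v)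
                 (fun l => forall l', leqb l l' <-> l = l')).
- move=> l IH [l'|l' v] /=; last by split.
  by split=> [/IH->|[]/IH].
- move=> l IHl u IHu [l'|l' v] /=; first by split.
  split; first by case/andP=> /IHl -> /IHu ->.
  by case=> <- <-; apply/andP; split; [apply/IHl | apply/IHu].
- move=> a [b|w] /=; last by split.
  by split; [move/eqP->|case=>->].
- move=> w IH [b|w'] /=; first by split.
  by split=> [/IH->|[]/IH].
Qed.

Lemma weqbP : Equality.axiom weqb.
Proof. by move=> u v; apply: (iffP idP); move/weqb_iff. Qed.

HB.instance Definition _ := hasDecEq.Build (word A) weqbP.

End WordEq.

Section Order1.
Variables (d : Order.disp_t) (X : orderType d).

(* write u = u_0 P(x_1) u_1 ... P(x_t) u_t : returns ([u_0;...;u_t], [x_1;...;x_t]) *)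
Fixpoint decomp (ls : seq (letter X)) : seq (seq X) * seq (word X) :=
  match ls with
  | [::] => ([:: [::]], [::])
  | LX x :: r =>
      let (segs, args) := decomp r in
      match segs with
      | s :: ss => ((x :: s) :: ss, args)
      | [::] => ([:: [:: x]], args)
      end
  | LP w :: r =>
      let (segs, args) := decomp r in ([::] :: segs, w :: args)
  end.

Definition cmpX (x y : X) : comparison :=
  if (x < y)%O then Lt else if x == y then Eq else Gt.

Fixpoint lexcmp (T : Type) (c : T -> T -> comparison) (s t : seq T) : comparison :=
  match s, t with
  | [::], [::] => Eq
  | [::], _ => Lt
  | _, [::] => Gt
  | a :: s', b :: t' =>
      match c a b with
      | Eq => lexcmp c s' t'
      | r => r
      end
  end.

Definition deglex (s t : seq X) : comparison :=
  match Nat.compare (size s) (size t) with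
  | Eq => lexcmp cmpX s t
  | r => r
  end.

(* comparison of wt(u) = (t, P, x_1, ..., P, x_t, u_0, ..., u_t) and wt(v),
   lexicographically, recursively on the x_i; n is fuel (see word_lt) *)
Fixpoint wcmp (n : nat) (u v : word X) : comparison :=
  match n with
  | 0 => Eq
  | n'.+1 =>
      let (su, au) := decomp (letters u) in
      let (sv, av) := decomp (letters v) in
      match Nat.compare (size au) (size av) with
      | Eq =>
          match lexcmp (wcmp n') au av with
          | Eq => lexcmp deglex su sv
          | r => r
          end
      | r => r
      end
  end.

(* u < v in order (1); the fuel wsize u + wsize v is sufficient for the
   recursion to bottom out on the actual words. *)
Definition word_lt (u v : word X) : bool :=
  if wcmp (wsize u + wsize v) u v is Lt then true else false.

End Order1.

(* K<X;P>: elements are formal K-linear combinations of Omega-words    *)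
(* (finite lists of (coefficient, word)); two lists denote the same     *)
(* element iff they have the same coefficient function [ocoef].         *)
Section Poly.
Local Open Scope ring_scope.
Variables (K : comNzRingType) (d : Order.disp_t) (X : orderType d).

Definition opoly := seq (K * word X).

Definition ocoef (f : opoly) (w : word X) : K := \sum_(e <- f | e.2 == w) e.1.

Definition psub (f g : opoly) : opoly := f ++ [seq (- e.1, e.2) | e <- g].

Definition lead (f : opoly) (w : word X) : Prop :=
  ocoef f w != 0 /\ forall v, ocoef f v != 0 -> v = w \/ word_lt v w.

Definition sRB (lam : K) (x y : word X) : opoly :=
  [:: (1, wcat (pw x) (pw y));
      (-1, pw (wcat (pw x) y));
      (-1, pw (wcat x (pw y)));
      (- lam, pw (wcat x y))].

(* star-words: Omega-words on X \cup {star}, star encoded as None *)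
Fixpoint starcount (u : word (option X)) : nat :=
  match u with
  | wsing l => lstarcount l
  | wcons l u' => lstarcount l + starcount u'
  end
with lstarcount (l : letter (option X)) : nat :=
  match l with
  | LX None => 1
  | LX (Some _) => 0
  | LP w => starcount w
  end.

Fixpoint subst (s : word X) (u : word (option X)) : word X :=
  match u with
  | wsing l => lsubst s l
  | wcons l u' => wcat (lsubst s l) (subst s u')
  end
with lsubst (s : word X) (l : letter (option X)) : word X :=
  match l with
  | LX None => s
  | LX (Some x) => wsing (LX x)
  | LP w => wsing (LP (subst s w))
  end.

Definition substp (u : word (option X)) (f : opoly) : opoly :=
  [seq (e.1, subst e.2 u) | e <- f].

Definition inId (lam : K) (f : opoly) : Prop :=
  exists l : seq (K * (word (option X) * (word X * word X))),
    (forall e, e \in l -> starcount e.2.1 = 1) /\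
    forall w, ocoef f w = \sum_(e <- l) e.1 * ocoef (substp e.2.1 (sRB lam e.2.2.1 e.2.2.2)) w.

Definition Irr (lam : K) (w : word X) : Prop :=
  forall (u : word (option X)) (x y v : word X),
    starcount u = 1 -> lead (sRB lam x y) v -> w <> subst v u.

End Poly.

Section RBWords.
Variable A : Type.

Definition isX (w : word A) : Prop :=
  all (fun l => if l is LX _ then true else false) (letters w).

Definition YPZ (Y Z : word A -> Prop) (w : word A) : Prop :=
  exists y z, Y y /\ Z z /\ w = wcat y (pw z).
Definition PZY (Y Z : word A -> Prop) (w : word A) : Prop :=
  exists z y, Z z /\ Y y /\ w = wcat (pw z) y.
Definition PZ (Z : word A -> Prop) (w : word A) : Prop :=
  exists z, Z z /\ w = pw z.

(* prodset T r U = T^r U  (so T^0 U = U, and T^(r+1) = prodset T r T) *)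
Fixpoint prodset (T : word A -> Prop) (r : nat) (U : word A -> Prop) : word A -> Prop :=
  match r with
  | 0 => U
  | r'.+1 => fun w => exists a b, T a /\ prodset T r' U b /\ w = wcat a b
  end.

Definition LambdaP (Y Z : word A -> Prop) (w : word A) : Prop :=
     (exists r, prodset (YPZ Y Z) r (YPZ Y Z) w)   (* (YP(Z))^(r+1), r+1 >= 1 *)
  \/ (exists r, prodset (YPZ Y Z) r Y w)
  \/ (exists r, prodset (PZY Y Z) r (PZY Y Z) w)   (* (P(Z)Y)^(r+1), r+1 >= 1 *)
  \/ (exists r, prodset (PZY Y Z) r (PZ Z) w).

Fixpoint Phin (n : nat) : word A -> Prop :=
  match n with
  | 0 => isX
  | n'.+1 => LambdaP isX (Phin n')
  end.

Definition Phi (w : word A) : Prop := exists n, Phin n w.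

End RBWords.

(* Main.v *)
Require Import Defs.
From HB Require Import structures.
From mathcomp Require Import all_boot all_order all_algebra.
From mathcomp Require Import zify.
From mathcomp.multinomials Require Import monalg.
From mathcomp Require Import finmap.
Set Implicit Arguments. Unset Strict Implicit. Unset Printing Implicit Defensive.
Import Order.TTheory GRing.Theory.
Local Open Scope ring_scope.

(** Both [Irr] and [Phi] are the words in which no two letters [P(_)] are
    adjacent, at any depth.  Such words span because the rewriting rule
    [P(x)P(y) -> P(P(x)y) + P(xP(y)) + lam P(xy)] strictly decreases the
    multiplicative weight [wgt], with [wgt x = 1] on generators and
    [wgt (P(w)) = wgt w + 1].

    For independence, the free module on ALL words carries a second product
    [dia], in which only the last letter of the left factor and the first letter
    of the right one interact: they are concatenated unless they are [P(x)] and
    [P(y)], in which case they are replaced by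
    [P(x dia P(y)) + P(P(x) dia y) + lam P(x dia y)].  This product is
    associative, so it makes the module a Rota-Baxter algebra, and the morphism
    [nf] from words to it kills the ideal while fixing the words of [Phi]. *)

(** * Words *)

Section WordChoice.
Variable A : choiceType.

(** Generic trees give words a choice structure, over which free modules are built. The node label
    tells a single letter, a longer word and a letter [P] apart. *)
Fixpoint wencode (u : word A) : GenTree.tree A :=
  match u with
  | wsing l => GenTree.Node 0 [:: lencode l]
  | wcons l u' => GenTree.Node 1 [:: lencode l; wencode u']
  end
with lencode (l : letter A) : GenTree.tree A :=
  match l with
  | LX a => GenTree.Leaf a
  | LP w => GenTree.Node 2 [:: wencode w]
  end.

Fixpoint wdecode (t : GenTree.tree A) : option (word A) :=
  match t with
  | GenTree.Node 0 [:: t1] => omap wsing (ldecode t1)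
  | GenTree.Node 1 [:: t1; t2] =>
      if ldecode t1 is Some l then omap (wcons l) (wdecode t2) else None
  | _ => None
  end
with ldecode (t : GenTree.tree A) : option (letter A) :=
  match t with
  | GenTree.Leaf a => Some (LX a)
  | GenTree.Node _ [:: t1] => omap LP (wdecode t1)
  | _ => None
  end.

Lemma wencodeK : pcancel wencode wdecode.
Proof.
apply: (@word_mut A (fun u => wdecode (wencode u) = Some u)
                    (fun l => ldecode (lencode l) = Some l)) => //=.
- by move=> l ->.
- by move=> l -> u ->.
- by move=> w ->.
Qed.

HB.instance Definition _ := PCanHasChoice wencodeK.

End WordChoice.

Section WordFacts.
Variable A : Type.
Implicit Types (u v w z : word A) (l : letter A).

Definition isP l : bool := if l is LP _ then true else false.
Definition whead u : letter A :=
  match u with wsing l => l | wcons l _ => l end.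
Fixpoint wlast u : letter A :=
  match u with wsing l => l | wcons _ u' => wlast u' end.

Fixpoint wgood u : bool :=
  match u with
  | wsing l => lgood l
  | wcons l u' => [&& lgood l, wgood u' & ~~ (isP l && isP (whead u'))]
  end
with lgood l : bool := if l is LP w then wgood w else true.

Lemma wcatA : associative (@wcat A).
Proof. by move=> u v w; elim: u => //= l u ->. Qed.

Lemma lsize_gt0 l : (0 < lsize l)%N. Proof. by case: l. Qed.

Lemma wsize_gt0 u : (0 < wsize u)%N.
Proof. by case: u => [l|l u] /=; have := lsize_gt0 l; lia. Qed.

Lemma whead_cat u v : whead (wcat u v) = whead u. Proof. by case: u. Qed.

Lemma wlast_cat u v : wlast (wcat u v) = wlast v. Proof. by elim: u. Qed.

Lemma wgood_cat u v :
  wgood (wcat u v)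
  = [&& wgood u, wgood v & ~~ (isP (wlast u) && isP (whead v))].
Proof.
elim: u => //= l u ->; rewrite whead_cat.
by case: (lgood l) (wgood u) (wgood v) (isP (wlast u)) (isP (whead v))
         (isP l) (isP (whead u)) => [] [] [] [] [] [] [].
Qed.

Lemma isX_good u : isX u -> wgood u /\ ~~ isP (whead u) /\ ~~ isP (wlast u).
Proof.
by rewrite /isX; elim: u => [[]|[a|w] u IH] //= /IH[-> [_ ->]].
Qed.

(** * Rota-Baxter words are the words without adjacent [P]'s *)

(** Factors that never begin with [P] create no adjacent pair at a junction. In the mirror version
    the condition sits on the last letters of the [T]-factors, so the closing factor from [U] may be
    any good word. *)
Lemma prodset_good_l (T U : word A -> Prop) r w :
  (forall a, T a -> wgood a /\ ~~ isP (whead a)) ->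
  (forall a, U a -> wgood a /\ ~~ isP (whead a)) ->
  prodset T r U w -> wgood w /\ ~~ isP (whead w).
Proof.
move=> hT hU; elim: r w => [|r IH] w /=; first exact: hU.
move=> [a [b [/hT[ga ha] [/IH[gb hb] ->]]]].
by rewrite wgood_cat whead_cat ga gb (negbTE hb) andbF.
Qed.

Lemma prodset_good_r (T U : word A -> Prop) r w :
  (forall a, T a -> wgood a /\ ~~ isP (wlast a)) ->
  (forall a, U a -> wgood a) ->
  prodset T r U w -> wgood w.
Proof.
move=> hT hU; elim: r w => [|r IH] w /=; first exact: hU.
move=> [a [b [/hT[ga ha] [/IH gb ->]]]].
by rewrite wgood_cat ga gb (negbTE ha).
Qed.

Lemma Phin_good n w : Phin n w -> wgood w.
Proof.
elim: n w => [|n IH] w /=; first by case/isX_good.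
have hYPZ a : YPZ (@isX A) (Phin n) a -> wgood a /\ ~~ isP (whead a).
  move=> [y [z [/isX_good[gy [hy ly]] [/IH gz ->]]]].
  by rewrite wgood_cat whead_cat gy hy (negbTE ly) /= gz.
have hPZY a : PZY (@isX A) (Phin n) a -> wgood a /\ ~~ isP (wlast a).
  move=> [z [y [/IH gz [/isX_good[gy [hy ly]] ->]]]].
  by rewrite wgood_cat wlast_cat gy ly (negbTE hy) /= gz.
case=> [[r]|[[r]|[[r]|[r]]]].
- by case/(prodset_good_l hYPZ hYPZ).
- by case/(prodset_good_l hYPZ) => // a /isX_good[? []].
- by apply: (prodset_good_r hPZY) => a /hPZY[].
- by apply: (prodset_good_r hPZY) => a [z [/IH gz ->]].
Qed.

(** * Cutting a word into alternating blocks *)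

Section Parse.
Variable Z : word A -> Prop.
Let Y := @isX A.

(** Here and in the next three lemmas, a block put in front of an alternating product shifts all
    brackets by one: $z\,(y_1z_1)(y_2z_2)\cdots=(z\,y_1)(z_1y_2)\cdots$. *)
Lemma prodset_pw_Y r z u :
  Z z -> prodset (YPZ Y Z) r Y u -> prodset (PZY Y Z) r (PZY Y Z) (wcat (pw z) u).
Proof.
elim: r z u => [|r IH] z u hz; first by move=> hu; exists z, u.
move=> [_ [b [[y [z' [hy [hz' ->]]]] [hb ->]]]].
exists (wcat (pw z) y), (wcat (pw z') b).
by split; [exists z, y | split; [apply: IH | rewrite !wcatA]].
Qed.

Lemma prodset_pw_YPZ r z u :
  Z z -> prodset (YPZ Y Z) r (YPZ Y Z) u ->
  prodset (PZY Y Z) r.+1 (PZ Z) (wcat (pw z) u).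
Proof.
elim: r z u => [|r IH] z u hz.
  move=> [y [z' [hy [hz' ->]]]]; exists (wcat (pw z) y), (pw z').
  by split; [exists z, y | split; [exists z' | rewrite wcatA]].
move=> [_ [b [[y [z' [hy [hz' ->]]]] [hb ->]]]].
exists (wcat (pw z) y), (wcat (pw z') b).
by split; [exists z, y | split; [apply: IH | rewrite !wcatA]].
Qed.

Lemma prodset_Y_PZ r y u :
  Y y -> prodset (PZY Y Z) r (PZ Z) u -> prodset (YPZ Y Z) r (YPZ Y Z) (wcat y u).
Proof.
elim: r y u => [|r IH] y u hy; first by move=> [z [hz ->]]; exists y, z.
move=> [_ [b [[z [y' [hz [hy' ->]]]] [hb ->]]]].
exists (wcat y (pw z)), (wcat y' b).
by split; [exists y, z | split; [apply: IH | rewrite !wcatA]].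
Qed.

Lemma prodset_Y_PZY r y u :
  Y y -> prodset (PZY Y Z) r (PZY Y Z) u -> prodset (YPZ Y Z) r.+1 Y (wcat y u).
Proof.
elim: r y u => [|r IH] y u hy.
  move=> [z [y' [hz [hy' ->]]]]; exists (wcat y (pw z)), y'.
  by split; [exists y, z | split => //; rewrite wcatA].
move=> [_ [b [[z [y' [hz [hy' ->]]]] [hb ->]]]].
exists (wcat y (pw z)), (wcat y' b).
by split; [exists y, z | split; [apply: IH | rewrite !wcatA]].
Qed.

Lemma prodset_cat_l (T U : word A -> Prop) r y u :
  (forall a, T a -> T (wcat y a)) -> (forall a, U a -> U (wcat y a)) ->
  prodset T r U u -> prodset T r U (wcat y u).
Proof.
move=> hT hU; case: r => [|r] /=; first exact: hU.
by move=> [a [b [/hT ha [hb ->]]]]; exists (wcat y a), b; rewrite wcatA.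
Qed.

Fixpoint args_in u : Prop :=
  match u with
  | wsing l => if l is LP z then Z z else True
  | wcons l u' => (if l is LP z then Z z else True) /\ args_in u'
  end.

(** The first letter selects two of the four families of [LambdaP], the last letter one of these
    two. A new first letter either joins the leading block of generators ([prodset_cat_l]) or opens
    a new block and shifts the brackets. *)
Lemma LambdaP_parse u : wgood u -> args_in u ->
  if isP (whead u)
  then (exists r, prodset (PZY Y Z) r (PZY Y Z) u)
       \/ (exists r, prodset (PZY Y Z) r (PZ Z) u)
  else (exists r, prodset (YPZ Y Z) r (YPZ Y Z) u)
       \/ (exists r, prodset (YPZ Y Z) r Y u).
Proof.
elim: u => [[a|z]|[a|z] u IH] /=.
- by move=> _ _; right; exists 0.
- by move=> _ hz; right; exists 0, z.
- move=> /andP[gu _] [_ /(IH gu)].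
  have hy : Y (wsing (LX a)) by [].
  case: ifP => _ [] [r hr].
  + by right; exists r.+1; apply: (prodset_Y_PZY hy hr).
  + by left; exists r; apply: (prodset_Y_PZ hy hr).
  + left; exists r.
    have hc b : YPZ Y Z b -> YPZ Y Z (wcat (wsing (LX a)) b).
      move=> [y [z [hy' [hz ->]]]]; exists (wcat (wsing (LX a)) y), z.
      by rewrite wcatA.
    exact: (prodset_cat_l hc hc hr).
  + right; exists r; apply: (@prodset_cat_l _ _ _ (wsing (LX a))) hr => //.
    move=> b [y [z [hy' [hz ->]]]]; exists (wcat (wsing (LX a)) y), z.
    by rewrite wcatA.
- move=> /and3P[gz gu nP] [hz /(IH gu)]; rewrite (negbTE nP) => -[] [r hr].
  + by right; exists r.+1; apply: (prodset_pw_YPZ hz hr).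
  + by left; exists r; apply: (prodset_pw_Y hz hr).
Qed.

End Parse.

(** An argument of [P] is strictly smaller than the word around it. Since [n] is any bound on the
    size and not the exact depth, all arguments land in the same level. *)
Lemma good_Phin n w : (wsize w <= n)%N -> wgood w -> Phin n w.
Proof.
elim: n w => [|n IH] w; first by have := wsize_gt0 w; lia.
move=> sw gw.
have : args_in (Phin n) w.
  elim: w sw gw => [[a|z]|[a|z] u IHu] //=; first by move=> s g; apply: IH.
    by move=> s g; split=> //; apply: IHu; [lia | case/andP: g].
  move=> s /and3P[gz gu _]; split; first by apply: IH => //; lia.
  by apply: IHu => //; lia.
move=> /(LambdaP_parse gw); rewrite /= /LambdaP.
by case: ifP => _; tauto.
Qed.

Lemma Phi_good w : Phi w <-> wgood w.
Proof.
split; first by case=> n /Phin_good.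
by move=> g; exists (wsize w); apply: good_Phin.
Qed.

End WordFacts.

(** * Linear extension from a basis *)

HB.lock Definition mlin (T : choiceType) (K : comNzRingType) (V : lmodType K)
    (h : T -> V) (g : {malg K[T]}) : V := \sum_(k <- msupp g) g@_k *: h k.

Section LinearExtension.
Variables (T : choiceType) (K : comNzRingType).
Local Notation M := {malg K[T]}.

Lemma malgUZ (c : K) (k : T) : << c *g k >> = c *: << k >> :> M.
Proof. by apply/malgP => k'; rewrite mcoeffZ !mcoeffU mulrnAr mulr1. Qed.

Section Lin.
Variables (V : lmodType K) (h : T -> V).

Lemma mlinE g : mlin h g = \sum_(k <- msupp g) g@_k *: h k.
Proof. by rewrite mlin.unlock. Qed.

(** Passing to a common finite set [D] allows sums over different supports to be compared term by
    term. *)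
Lemma mlinEw (D : {fset T}) g : (msupp g `<=` D)%fset ->
  mlin h g = \sum_(k <- D) g@_k *: h k.
Proof.
move=> le; rewrite mlinE [LHS](big_fset_incl _ le) => //= x xd /mcoeff_outdom ->.
by rewrite scale0r.
Qed.

Lemma mlin_is_linear : linear (mlin h).
Proof.
move=> c f g; set D := (msupp (c *: f + g) `|` msupp f `|` msupp g)%fset.
rewrite (@mlinEw D) ?(@mlinEw D f) ?(@mlinEw D g); first 1 last.
- by apply/fsubsetP => x; rewrite !inE => ->; rewrite !orbT.
- by apply/fsubsetP => x; rewrite !inE => ->; rewrite !orbT.
- by apply/fsubsetP => x; rewrite !inE => ->.
rewrite scaler_sumr -big_split; apply: eq_bigr => k _ /=.
by rewrite mcoeffD mcoeffZ scalerDl scalerA.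
Qed.

HB.instance Definition _ := GRing.isLinear.Build K M V _ (mlin h) mlin_is_linear.

Lemma mlinU k : mlin h << k >> = h k.
Proof. by rewrite (mlinEw msuppU_le) big_seq_fset1 mcoeffUU scale1r. Qed.

End Lin.

Lemma malg_linear_ind (Q : M -> Prop) :
  Q 0 -> (forall k, Q << k >>) ->
  (forall c f g, Q f -> Q g -> Q (c *: f + g)) -> forall g, Q g.
Proof.
move=> Q0 Q1 QD g; rewrite [g]monalgE.
elim/big_rec: _ => // k f _ Qf.
by rewrite malgUZ; apply: QD.
Qed.

Variable b : T -> T -> M.

Definition mbilin (f g : M) : M := mlin (fun u => mlin (b u) g) f.

Lemma mbilin_is_linear f : linear (mbilin f).
Proof.
move=> c g h; rewrite /mbilin ![mlin _ f]mlinE.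
rewrite scaler_sumr -big_split; apply: eq_bigr => k _ /=.
by rewrite linearP scalerDr !scalerA mulrC.
Qed.

HB.instance Definition _ f :=
  GRing.isLinear.Build K M M _ (mbilin f) (@mbilin_is_linear f).

Lemma mbilinDl f g h : mbilin (f + g) h = mbilin f h + mbilin g h.
Proof. exact: linearD. Qed.

Lemma mbilinZl c f h : mbilin (c *: f) h = c *: mbilin f h.
Proof. exact: linearZ. Qed.

Lemma mbilin0l h : mbilin 0 h = 0.
Proof. exact: linear0. Qed.

Lemma mbilinDr f g h : mbilin f (g + h) = mbilin f g + mbilin f h.
Proof. exact: linearD. Qed.

Lemma mbilinZr c f h : mbilin f (c *: h) = c *: mbilin f h.
Proof. exact: linearZ. Qed.

Lemma mbilin0r f : mbilin f 0 = 0.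
Proof. exact: linear0. Qed.

Lemma mbilinU u v : mbilin << u >> << v >> = b u v.
Proof. by rewrite /mbilin !mlinU. Qed.

End LinearExtension.

(** With four independent tables, one statement serves both the associativity of a single product
    and the mixed laws between [mcat] and [dia]. *)
Lemma mbilin_assoc (T : choiceType) (K : comNzRingType)
    (b1 b2 b3 b4 : T -> T -> {malg K[T]}) :
  (forall u v w, mbilin b1 (b2 u v) << w >> = mbilin b3 << u >> (b4 v w)) ->
  forall f g h, mbilin b1 (mbilin b2 f g) h = mbilin b3 f (mbilin b4 g h).
Proof.
move=> H f g h; elim/malg_linear_ind: f => [|u|c f f' Hf Hf'].
- by rewrite !mbilin0l.
- elim/malg_linear_ind: g => [|v|c g g' Hg Hg'].
  + by rewrite mbilin0l !mbilin0r mbilin0l.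
  + elim/malg_linear_ind: h => [|w|c h h' Hh Hh'].
    * by rewrite !mbilin0r.
    * by rewrite !mbilinU.
    * by rewrite !mbilinDr !mbilinZr Hh Hh'.
  + by rewrite mbilinDl mbilinZl !mbilinDr !mbilinZr mbilinDl mbilinZl Hg Hg'.
- by rewrite !(mbilinDl, mbilinZl) Hf Hf'.
Qed.

(** * The Rota-Baxter product on all words *)

Section RotaBaxterProduct.
Variables (K : comNzRingType) (X : choiceType) (lam : K).
Local Notation M := {malg K[word X]}.
Implicit Types (u v w x y z : word X) (l : letter X) (f g h : M).

Definition mcat : M -> M -> M := mbilin (fun u v => << wcat u v >>).
Definition mP : M -> M := mlin (fun w => << pw w >>).

Lemma mcatU u v : mcat << u >> << v >> = << wcat u v >>.
Proof. exact: mbilinU. Qed.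

Lemma mPU u : mP << u >> = << pw u >>.
Proof. exact: mlinU. Qed.

Lemma mP0 : mP 0 = 0. Proof. exact: linear0. Qed.
Lemma mPD f g : mP (f + g) = mP f + mP g. Proof. exact: linearD. Qed.
Lemma mPZ c f : mP (c *: f) = c *: mP f. Proof. exact: linearZ. Qed.

Lemma mcatA : associative mcat.
Proof.
by move=> f g h; apply/esym/mbilin_assoc => u v w; rewrite -!/mcat !mcatU wcatA.
Qed.

(* [jprod q] multiplies by letting the last letter of the first word and the
   first letter of the second one interact through [q]. *)
Fixpoint jprod (q : letter X -> letter X -> M) u v : M :=
  match u with
  | wsing l =>
      match v with
      | wsing l' => q l l'
      | wcons l' v' => mcat (q l l') << v' >>
      end
  | wcons l u' => mcat << wsing l >> (jprod q u' v)
  end.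

(** Open recursion: [pr] stands for the product itself, called on pairs of smaller total size. *)
Definition rbletter (pr : word X -> word X -> M) l l' : M :=
  match l, l' with
  | LP x, LP y => mP (pr x (pw y) + pr (pw x) y + lam *: pr x y)
  | _, _ => << wcons l (wsing l') >>
  end.

(* The recursive calls of the Rota-Baxter product decrease the total size, so
   [n := wsize u + wsize v] is enough fuel. *)
Fixpoint fprod (n : nat) u v : M :=
  if n is n'.+1 then jprod (rbletter (fprod n')) u v else 0.

Definition wprod u v : M := fprod (wsize u + wsize v) u v.

Lemma jprod_ext q q' N u v :
  (forall l l', (lsize l + lsize l' <= N)%N -> q l l' = q' l l') ->
  (wsize u + wsize v <= N)%N -> jprod q u v = jprod q' u v.
Proof.
move=> e; elim: u => [l|l u IH] /=; last by move=> s; rewrite IH //; lia.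
by case: v => [l'|l' v] /= s; rewrite e //; lia.
Qed.

Lemma rbletter_ext (pr pr' : word X -> word X -> M) N :
  (forall u v, (wsize u + wsize v <= N)%N -> pr u v = pr' u v) ->
  forall l l', (lsize l + lsize l' <= N.+1)%N ->
  rbletter pr l l' = rbletter pr' l l'.
Proof.
move=> e [a|x] [b|y] /= s; [by [] | by [] | by [] |].
rewrite (e x (pw y)); last by rewrite /=; lia.
rewrite (e (pw x) y); last by rewrite /=; lia.
by rewrite (e x y); last by lia.
Qed.

Lemma fprod_fuel n m u v :
  (wsize u + wsize v <= n)%N -> (wsize u + wsize v <= m)%N ->
  fprod n u v = fprod m u v.
Proof.
elim: n m u v => [|n IH] [|m] u v; try by have := wsize_gt0 u; lia.
(* The recursive calls run on fuel [n] and [m], so the induction hypothesis covers sizes up to the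
   smaller of the two. *)
move=> sn sm; apply: (@jprod_ext _ _ (minn n m).+1); last by lia.
by apply: rbletter_ext => x y s; apply: IH; lia.
Qed.

(** The recursion equation of the product, in which the fuel no longer appears. *)
Lemma wprodE u v : wprod u v = jprod (rbletter wprod) u v.
Proof.
rewrite {1}/wprod; case E : (_ + _)%N => [|n]; first by have := wsize_gt0 u; lia.
apply: (@jprod_ext _ _ n.+1); last by rewrite E.
by apply: rbletter_ext => x y s; apply: fprod_fuel; lia.
Qed.

Definition dia : M -> M -> M := mbilin wprod.

Lemma diaU u v : dia << u >> << v >> = wprod u v.
Proof. exact: mbilinU. Qed.

Lemma dia0l f : dia 0 f = 0. Proof. exact: mbilin0l. Qed.
Lemma diaDl f g h : dia (f + g) h = dia f h + dia g h.
Proof. exact: mbilinDl. Qed.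
Lemma diaZl c f h : dia (c *: f) h = c *: dia f h.
Proof. exact: mbilinZl. Qed.

Lemma dia0r f : dia f 0 = 0. Proof. exact: mbilin0r. Qed.
Lemma diaDr f g h : dia f (g + h) = dia f g + dia f h.
Proof. exact: mbilinDr. Qed.
Lemma diaZr c f h : dia f (c *: h) = c *: dia f h.
Proof. exact: mbilinZr. Qed.

Lemma wprod_cons l u v : wprod (wcons l u) v = mcat << wsing l >> (wprod u v).
Proof. by rewrite !wprodE. Qed.

(** Only the two letters at the junction interact, so a prefix of the left factor is inert, and
    likewise a suffix of the right factor. *)
Lemma wprod_catl u v w : wprod (wcat u v) w = mcat << u >> (wprod v w).
Proof.
elim: u => [l|l u IH] /=; first by rewrite wprod_cons.
by rewrite wprod_cons IH mcatA mcatU.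
Qed.

Lemma wprod_catr u v w : wprod u (wcat v w) = mcat (wprod u v) << w >>.
Proof.
rewrite !wprodE; elim: u => [l|l u IH] /=; last by rewrite IH mcatA.
by case: v => [l'|l' v] //=; rewrite -mcatA mcatU.
Qed.

Lemma dia_mcatl f g h : dia (mcat f g) h = mcat f (dia g h).
Proof.
by apply: mbilin_assoc => u v w; rewrite -/dia -/mcat diaU wprod_catl.
Qed.

Lemma dia_mcatr f g h : dia f (mcat g h) = mcat (dia f g) h.
Proof.
by apply/esym/mbilin_assoc => u v w; rewrite -/dia -/mcat diaU wprod_catr.
Qed.

Lemma wprod_noPP u v : ~~ (isP (wlast u) && isP (whead v)) ->
  wprod u v = << wcat u v >>.
Proof.
rewrite wprodE; elim: u => [l|l u IH] /=; last by move=> /IH->; rewrite mcatU.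
by case: v => [l'|l' v] /=; case: l l' => [a|x] [b|y] //= _; rewrite mcatU.
Qed.

Lemma dia_Xl a f : dia << wsing (LX a) >> f = mcat << wsing (LX a) >> f.
Proof.
elim/malg_linear_ind: f => [|u|c f f' Hf Hf'].
- by rewrite /dia /mcat !mbilin0r.
- by rewrite diaU mcatU wprod_noPP.
- by move: Hf Hf'; rewrite /dia /mcat !mbilinDr !mbilinZr => -> ->.
Qed.

Lemma dia_Xr a f : dia f << wsing (LX a) >> = mcat f << wsing (LX a) >>.
Proof.
elim/malg_linear_ind: f => [|u|c f f' Hf Hf'].
- by rewrite /dia /mcat !mbilin0l.
- by rewrite diaU mcatU wprod_noPP //= andbF.
- by move: Hf Hf'; rewrite /dia /mcat !mbilinDl !mbilinZl => -> ->.
Qed.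

(** On basis words this is the clause of [rbletter] for two letters [P]; bilinearity does the
    rest. *)
Lemma rota_baxter f g :
  dia (mP f) (mP g) = mP (dia f (mP g) + dia (mP f) g + lam *: dia f g).
Proof.
elim/malg_linear_ind: f => [|u|c f f' Hf Hf'].
- by rewrite mP0 !dia0l scaler0 !addr0 mP0.
- elim/malg_linear_ind: g => [|v|c g g' Hg Hg'].
  + by rewrite mP0 !dia0r scaler0 !addr0 mP0.
  + by rewrite !mPU !diaU wprodE.
  + rewrite (mPD (c *: g)) (mPZ c) !diaDr !diaZr Hg Hg' -mPZ -mPD; congr (mP _).
    by rewrite !scalerDr !scalerA [lam * c]mulrC [RHS](AC (2*2*2) ((1*3*5)*(2*4*6))).
- rewrite (mPD (c *: f)) (mPZ c) !diaDl !diaZl Hf Hf' -mPZ -mPD; congr (mP _).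
  by rewrite !scalerDr !scalerA [lam * c]mulrC [RHS](AC (2*2*2) ((1*3*5)*(2*4*6))).
Qed.

(** Two uses of [rota_baxter] give seven triple products, each having lost at least one of the three
    outer [mP]. [dia_PPr] gives the same seven with the other bracketing. *)
Lemma dia_PPl f g h :
  dia (dia (mP f) (mP g)) (mP h)
  = mP (dia (dia f (mP g)) (mP h) + dia (dia (mP f) g) (mP h)
        + lam *: dia (dia f g) (mP h) + dia (dia (mP f) (mP g)) h
        + (lam *: dia (dia f (mP g)) h + lam *: dia (dia (mP f) g) h
           + (lam * lam) *: dia (dia f g) h)).
Proof.
have := rota_baxter f g; set s := (X in mP X) => es.
(* Folding [mP s] back keeps [dia (dia (mP f) (mP g)) h] a triple product, as an induction on
   associativity requires. *)
by rewrite {1}es rota_baxter -es /s !diaDl !diaZl !scalerDr scalerA.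
Qed.

Lemma dia_PPr f g h :
  dia (mP f) (dia (mP g) (mP h))
  = mP (dia f (dia (mP g) (mP h))
        + (dia (mP f) (dia g (mP h)) + dia (mP f) (dia (mP g) h)
           + lam *: dia (mP f) (dia g h))
        + (lam *: dia f (dia g (mP h)) + lam *: dia f (dia (mP g) h)
           + (lam * lam) *: dia f (dia g h))).
Proof.
have := rota_baxter g h; set s := (X in mP X) => es.
by rewrite {1}es rota_baxter -es /s !diaDr !diaZr !scalerDr scalerA.
Qed.

(** Induction on the total size. Inert outer letters are pulled out, and a middle word of several
    letters keeps its two junctions apart. Among single letters a generator merely concatenates,
    which leaves the case of three letters [P]. *)
Lemma wprodA u v w : dia (wprod u v) << w >> = dia << u >> (wprod v w).
Proof.
have [n] := ubnP (wsize u + wsize v + wsize w).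
elim: n u v w => // n IH u v w lt_n.
case: u lt_n => [a|a u] lt_n; last first.
  have := IH u v w; rewrite wprod_cons dia_mcatl -(mcatU (wsing a)) dia_mcatl => -> //.
  by move: lt_n => /=; have := lsize_gt0 a; lia.
case: w lt_n => [c|c w] lt_n; last first.
  have := IH (wsing a) v (wsing c).
  rewrite -[wcons c w]/(wcat (wsing c) w) wprod_catr -mcatU !dia_mcatr => -> //.
  by move: lt_n => /=; have := wsize_gt0 w; lia.
case: v lt_n => [b|b v] lt_n; last first.
  rewrite -[wcons b v]/(wcat (wsing b) v) wprod_catr wprod_catl dia_mcatl.
  by rewrite diaU dia_mcatr diaU.
rewrite -!diaU; case: b lt_n => [b|y] lt_n.
  by rewrite dia_Xl dia_Xr dia_mcatl dia_mcatr dia_Xl dia_Xr mcatA.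
case: a lt_n => [a|x] lt_n; first by rewrite !dia_Xl dia_mcatl.
case: c lt_n => [c|z] lt_n; first by rewrite !dia_Xr dia_mcatr.
(* The 3 counts the outer letters [P]; every term of the two expansions has lost at least one of
   them. *)
have A x' y' z' : (wsize x' + wsize y' + wsize z' < wsize x + wsize y + wsize z + 3)%N ->
    dia (dia << x' >> << y' >>) << z' >> = dia << x' >> (dia << y' >> << z' >>).
  by move=> lt'; rewrite !diaU; apply: IH; move: lt_n => /=; lia.
rewrite -!/(pw _) -!mPU dia_PPl dia_PPr !mPU; congr (mP _).
rewrite !A /=; try lia.
(* The two expansions list the same seven terms in different orders. *)
by rewrite [RHS](AC (1*3*3) (1*2*5*3*(6*4*7))).
Qed.

Lemma diaA : associative dia.
Proof.
by move=> f g h; apply/esym/mbilin_assoc => u v w; rewrite -/dia wprodA.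
Qed.

(** * Normal forms *)

Fixpoint nf u : M :=
  match u with
  | wsing l => lnf l
  | wcons l u' => dia (lnf l) (nf u')
  end
with lnf l : M :=
  match l with
  | LX a => << wsing (LX a) >>
  | LP w => mP (nf w)
  end.

(** [nf] multiplies letters from the right; associativity of [dia] makes it respect every other cut
    of the word. *)
Lemma nf_cat u v : nf (wcat u v) = dia (nf u) (nf v).
Proof. by elim: u => //= l u ->; rewrite diaA. Qed.

Lemma nf_good u : wgood u -> nf u = << u >>.
Proof.
apply: (@word_mut X (fun u => wgood u -> nf u = << u >>)
                    (fun l => lgood l -> lnf l = << wsing l >>)) => //=.
- move=> l IHl w IHw /and3P[/IHl-> /IHw-> nPP].
  by rewrite diaU wprod_noPP.
- by move=> w IH /IH->; rewrite mPU.
Qed.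

End RotaBaxterProduct.

(** * Contexts *)

Section Contexts.
Variables (d : Order.disp_t) (X : orderType d).
Implicit Types (s w x y : word X) (u v : word (option X)).

(** The redex of the rewriting rule; [lead_sRB] shows that it is the leading word of the
    relation. *)
Definition PP x y : word X := wcat (pw x) (pw y).

Fixpoint wembed w : word (option X) :=
  match w with
  | wsing l => wsing (lembed l)
  | wcons l w' => wcons (lembed l) (wembed w')
  end
with lembed (l : letter X) : letter (option X) :=
  match l with
  | LX a => LX (Some a)
  | LP w => LP (wembed w)
  end.

Lemma starcount_embed w : starcount (wembed w) = 0%N.
Proof.
by apply: (@word_mut X (fun w => starcount (wembed w) = 0%N)
                    (fun l => lstarcount (lembed l) = 0%N)) => //= l -> w' ->.
Qed.

Lemma subst_embed s w : subst s (wembed w) = w.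
Proof.
apply: (@word_mut X (fun w => subst s (wembed w) = w)
                    (fun l => lsubst s (lembed l) = wsing l)) => //=.
  by move=> l -> w' ->.
by move=> w' ->.
Qed.

Lemma starcount_cat u v : starcount (wcat u v) = (starcount u + starcount v)%N.
Proof. by elim: u => //= l u ->; rewrite addnA. Qed.

Lemma subst_cat s u v : subst s (wcat u v) = wcat (subst s u) (subst s v).
Proof. by elim: u => //= l u ->; rewrite wcatA. Qed.

Lemma subst_nostar s s' u : starcount u = 0%N -> subst s u = subst s' u.
Proof.
apply: (@word_mut (option X)
  (fun u => starcount u = 0%N -> subst s u = subst s' u)
  (fun l => lstarcount l = 0%N -> lsubst s l = lsubst s' l)) => //=.
- move=> l IHl v IHv /eqP; rewrite addn_eq0 => /andP[/eqP/IHl-> /eqP/IHv->] //.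
- by case.
- by move=> w IH /IH->.
Qed.

Lemma lsubst_nostar s s' (l : letter (option X)) :
  lstarcount l = 0%N -> lsubst s l = lsubst s' l.
Proof. exact: (@subst_nostar s s' (wsing l)). Qed.

Lemma addn_eq1 m n : (m + n = 1)%N -> (m = 1 /\ n = 0)%N \/ (m = 0 /\ n = 1)%N.
Proof. lia. Qed.

(** The adjacent pair lies inside the first letter, inside the tail, or at their junction; the star
    marks its place and the rest of the word, embedded without star, forms the context. *)
Lemma bad_subst w : ~~ wgood w ->
  exists u x y, starcount u = 1%N /\ w = subst (PP x y) u.
Proof.
apply: (@word_mut X
  (fun w => ~~ wgood w -> exists u x y, starcount u = 1%N /\ w = subst (PP x y) u)
  (fun l => ~~ lgood l ->
     exists u x y, starcount u = 1%N /\ wsing l = subst (PP x y) u)) => //=.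
- move=> l IHl u IHu.
  case: (boolP (lgood l)) IHl => /= [_ _|_ /(_ isT)].
    case: (boolP (wgood u)) IHu => /= [_ _|_ /(_ isT) [v [x [y [cv ->]]]] _].
      (* Both parts are good, so the pair consists of the first letter and the head of the tail. *)
      case: l => [//|x]; case: u => [[//|y]|[//|y] u] _.
        by exists (wsing (LX None)), x, y.
      exists (wcons (LX None) (wembed u)), x, y.
      by rewrite /= starcount_embed subst_embed.
    exists (wcat (wsing (lembed l)) v), x, y; rewrite starcount_cat subst_cat cv.
    by rewrite (starcount_embed (wsing l)) (subst_embed _ (wsing l)).
  move=> [v [x [y [cv e]]]] _; exists (wcat v (wembed u)), x, y.
  by rewrite starcount_cat subst_cat cv starcount_embed subst_embed -e.
- move=> w' IH /IH[v [x [y [cv ->]]]].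
  by exists (wsing (LP v)), x, y.
Qed.

Lemma good_subst s u : (0 < starcount u)%N -> wgood (subst s u) -> wgood s.
Proof.
apply: (@word_mut (option X)
  (fun u => (0 < starcount u)%N -> wgood (subst s u) -> wgood s)
  (fun l => (0 < lstarcount l)%N -> wgood (lsubst s l) -> wgood s)) => //=.
- move=> l IHl v IHv; rewrite addn_gt0 wgood_cat => hc /and3P[gl gv _].
  by case/orP: hc => [/IHl|/IHv]; apply.
- by case.
Qed.

(* [wgt] is strictly decreased by the rewriting rule of the Rota-Baxter
   relation: with [a = wgt x] and [b = wgt y], [(a + 1) * (b + 1)] exceeds
   [(a + 1) * b + 1], [a * (b + 1) + 1] and [a * b + 1]. *)
Fixpoint wgt w : nat :=
  match w with
  | wsing l => lwgt l
  | wcons l w' => (lwgt l * wgt w')%N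
  end
with lwgt (l : letter X) : nat :=
  if l is LP w then (wgt w).+1 else 1%N.

Lemma wgt_cat w w' : wgt (wcat w w') = (wgt w * wgt w')%N.
Proof. by elim: w => //= l w ->; rewrite mulnA. Qed.

Lemma wgt_gt0 w : (0 < wgt w)%N.
Proof.
apply: (@word_mut X (fun w => 0 < wgt w)%N (fun l => 0 < lwgt l)%N) => //= l hl w'.
by rewrite muln_gt0 hl.
Qed.

(** The weight is multiplicative with positive values, and with a single star only one factor varies
    at each layer, so strictness survives. *)
Lemma wgt_subst s s' u : (wgt s < wgt s')%N -> starcount u = 1%N ->
  (wgt (subst s u) < wgt (subst s' u))%N.
Proof.
move=> lt_s; apply: (@word_mut (option X)
  (fun u => starcount u = 1%N -> wgt (subst s u) < wgt (subst s' u))%N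
  (fun l => lstarcount l = 1%N -> wgt (lsubst s l) < wgt (lsubst s' l))%N) => //=.
- move=> l IHl v IHv /addn_eq1[[/IHl h1 h0]|[h0 /IHv h1]]; rewrite !wgt_cat.
    by rewrite (subst_nostar s s' h0) ltn_pmul2r // wgt_gt0.
  by rewrite (lsubst_nostar s s' h0) ltn_pmul2l // wgt_gt0.
- by case.
Qed.

End Contexts.

(** * Leading words and irreducible words *)

Section Leading.
Variables (K : comNzRingType) (d : Order.disp_t) (X : orderType d) (lam : K).
Implicit Types (w x y z : word X).

(** The first entry of the weight sequence decides: one top-level [P] against two. *)
Lemma word_lt_pw_PP x y z : word_lt (pw z) (PP x y).
Proof. by rewrite /word_lt; case E : (_ + _)%N. Qed.

Lemma word_lt_PP_pw x y z : word_lt (PP x y) (pw z) = false.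
Proof. by rewrite /word_lt; case E : (_ + _)%N. Qed.

Lemma ocoef_sRB_PP x y : ocoef (sRB lam x y) (PP x y) = 1.
Proof. by rewrite /ocoef /sRB !big_cons big_nil /= eqxx addr0. Qed.

Lemma ocoef_sRB_neq0 x y v :
  ocoef (sRB lam x y) v != 0 -> v = PP x y \/ exists z, v = pw z.
Proof.
rewrite /ocoef /sRB !big_cons big_nil /=.
case: ifP => [/eqP<-|_]; first by left.
case: ifP => [/eqP<-|_]; first by right; eexists.
case: ifP => [/eqP<-|_]; first by right; eexists.
case: ifP => [/eqP<-|_]; first by right; eexists.
by rewrite eqxx.
Qed.

(** [PP x y] has coefficient 1, nonzero in [K], and any other word of the relation is a single
    letter [P(z)], hence smaller, whatever [lam] is. *)
Lemma lead_sRB x y v : lead (sRB lam x y) v <-> v = PP x y.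
Proof.
split=> [[nz max]|->].
  case: (ocoef_sRB_neq0 nz) => // -[z ev].
  have : ocoef (sRB lam x y) (PP x y) != 0 by rewrite ocoef_sRB_PP oner_eq0.
  by move=> /max[//|]; rewrite ev word_lt_PP_pw.
split; first by rewrite ocoef_sRB_PP oner_eq0.
by move=> w /ocoef_sRB_neq0[->|[z ->]]; [left | right; apply: word_lt_pw_PP].
Qed.

Lemma Irr_good w : Irr lam w <-> wgood w.
Proof.
split=> [irr|gw u x y v cu /lead_sRB-> ew].
  apply: contraT => /bad_subst[u [x [y [cu ew]]]].
  by case: (irr u x y _ cu _ ew); apply/lead_sRB.
have := @good_subst _ _ (PP x y) u; rewrite cu -ew gw => /(_ isT isT).
by rewrite /= !andbF.
Qed.

End Leading.

(** * The ideal *)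

Section Ideal.
Variables (K : comNzRingType) (d : Order.disp_t) (X : orderType d) (lam : K).
Local Notation M := {malg K[word X]}.
Implicit Types (f g : opoly K X) (w x y : word X).

(** In the free module, lists with the same coefficient function become equal elements. *)
Definition opoly_malg f : M := \sum_(e <- f) e.1 *: << e.2 >>.

Lemma mcoeff_opoly f w : (opoly_malg f)@_w = ocoef f w.
Proof.
rewrite /ocoef /opoly_malg raddf_sum [RHS]big_mkcond; apply: eq_bigr => e _ /=.
by rewrite mcoeffZ mcoeffU; case: eqP => _; rewrite ?mulr1 ?mulr0.
Qed.

Lemma opoly_malg_cat f g : opoly_malg (f ++ g) = opoly_malg f + opoly_malg g.
Proof. exact: big_cat. Qed.

Lemma opoly_malg_scale c f :
  opoly_malg [seq (c * e.1, e.2) | e <- f] = c *: opoly_malg f.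
Proof.
rewrite /opoly_malg big_map scaler_sumr.
by apply: eq_bigr => e _; rewrite scalerA.
Qed.

Lemma opoly_malg_psub f g : opoly_malg (psub f g) = opoly_malg f - opoly_malg g.
Proof.
rewrite /psub opoly_malg_cat -scaleN1r -opoly_malg_scale.
by congr (_ + opoly_malg _); apply: eq_map => e; rewrite mulN1r.
Qed.

Definition inIdM (m : M) : Prop :=
  exists l : seq (K * (word (option X) * (word X * word X))),
    (forall e, e \in l -> starcount e.2.1 = 1%N) /\
    m = \sum_(e <- l) e.1 *: opoly_malg (substp e.2.1 (sRB lam e.2.2.1 e.2.2.2)).

Lemma inIdE f : inId lam f <-> inIdM (opoly_malg f).
Proof.
split=> -[l [hl e]]; exists l; split=> //.
  apply/malgP => w; rewrite mcoeff_opoly e raddf_sum; apply: eq_bigr => t _.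
  by rewrite /= mcoeffZ mcoeff_opoly.
move=> w; rewrite -mcoeff_opoly e raddf_sum; apply: eq_bigr => t _.
by rewrite /= mcoeffZ mcoeff_opoly.
Qed.

Lemma inIdM0 : inIdM 0.
Proof. by exists [::]; rewrite big_nil. Qed.

Lemma inIdMD m m' : inIdM m -> inIdM m' -> inIdM (m + m').
Proof.
move=> [l [hl ->]] [l' [hl' ->]]; exists (l ++ l'); rewrite big_cat; split=> //.
by move=> e; rewrite mem_cat => /orP[/hl|/hl'].
Qed.

Lemma inIdMZ c m : inIdM m -> inIdM (c *: m).
Proof.
move=> [l [hl ->]]; exists [seq (c * e.1, e.2) | e <- l]; split.
  by move=> _ /mapP[e /hl he ->].
by rewrite big_map scaler_sumr; apply: eq_bigr => e _; rewrite scalerA.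
Qed.

Lemma inIdM_subst u x y : starcount u = 1%N ->
  inIdM (<< subst (PP x y) u >> - << subst (pw (wcat (pw x) y)) u >>
         - << subst (pw (wcat x (pw y))) u >> - lam *: << subst (pw (wcat x y)) u >>).
Proof.
move=> cu; exists [:: (1, (u, (x, y)))]; split.
  by move=> e; rewrite inE => /eqP->.
rewrite big_seq1 scale1r /opoly_malg /= !big_cons big_nil /=.
by rewrite scale1r !scaleN1r scaleNr addr0 !addrA.
Qed.

(** * Spanning modulo the ideal, by induction on the weight *)

Lemma span_word w : exists g,
  (forall e, e \in g -> wgood e.2) /\ inIdM (<< w >> - opoly_malg g).
Proof.
have [n] := ubnP (wgt w); elim: n w => // n IH w lt_n.
case: (boolP (wgood w)) => [gw|/bad_subst[u [x [y [cu ew]]]]].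
  exists [:: (1, w)]; split; first by move=> e; rewrite inE => /eqP->.
  by rewrite /opoly_malg big_seq1 scale1r subrr; apply: inIdM0.
have step z : (wgt z < wgt (PP x y))%N -> exists g,
    (forall e, e \in g -> wgood e.2) /\ inIdM (<< subst z u >> - opoly_malg g).
  move=> lt_z; apply: IH; have := wgt_subst lt_z cu.
  by rewrite -ew; lia.
have x0 := wgt_gt0 x; have y0 := wgt_gt0 y.
have [|g1 [P1 I1]] := step (pw (wcat (pw x) y)).
  by rewrite /= ?wgt_cat /=; nia.
have [|g2 [P2 I2]] := step (pw (wcat x (pw y))).
  by rewrite /= ?wgt_cat /=; nia.
have [|g3 [P3 I3]] := step (pw (wcat x y)).
  by rewrite /= ?wgt_cat /=; nia.
exists (g1 ++ g2 ++ [seq (lam * e.1, e.2) | e <- g3]); split.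
  move=> e; rewrite !mem_cat => /or3P[/P1|/P2|/mapP[e' /P3 ? ->]] //.
(* Adding the relation in context to the three congruences, the last one scaled by [lam], cancels
   the three intermediate words. *)
have := inIdMD (inIdMD (inIdMD (inIdM_subst x y cu) I1) I2) (inIdMZ lam I3).
rewrite -ew !opoly_malg_cat opoly_malg_scale scalerBr !opprD !addrA.
by rewrite (ACl ((1*6*8*10)*(2*5)*(3*7)*(4*9))) /= !addNr !addr0.
Qed.

Lemma span_opoly f : exists g,
  (forall e, e \in g -> wgood e.2) /\ inIdM (opoly_malg f - opoly_malg g).
Proof.
elim: f => [|[c w] f [g [Pg Ig]]].
  by exists [::]; rewrite subrr; split=> //; apply: inIdM0.
have [h [Ph Ih]] := span_word w.
exists ([seq (c * e.1, e.2) | e <- h] ++ g); split.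
  by move=> e; rewrite mem_cat => /orP[/mapP[e' /Ph ? ->]|/Pg].
have := inIdMD (inIdMZ c Ih) Ig.
rewrite opoly_malg_cat opoly_malg_scale /opoly_malg big_cons /=.
by rewrite scalerBr opprD addrACA.
Qed.

(** * Linear independence modulo the ideal, by normal forms *)

Definition lnform : M -> M := mlin (nf lam).

Lemma mP_sum (I : Type) (r : seq I) (c : I -> K) (F : I -> M) :
  mP (\sum_(i <- r) c i *: F i) = \sum_(i <- r) c i *: mP (F i).
Proof.
rewrite (big_morph (@mP K X) (@mPD _ _) (mP0 _ _)).
by apply: eq_bigr => i _; rewrite mPZ.
Qed.

Lemma dia_suml (I : Type) (r : seq I) (c : I -> K) (F : I -> M) h :
  dia lam (\sum_(i <- r) c i *: F i) h = \sum_(i <- r) c i *: dia lam (F i) h.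
Proof.
rewrite (big_morph (fun m => dia lam m h) (fun _ _ => diaDl _ _ _ _) (dia0l _ _)).
by apply: eq_bigr => i _; rewrite diaZl.
Qed.

Lemma dia_sumr (I : Type) (r : seq I) (c : I -> K) (F : I -> M) h :
  dia lam h (\sum_(i <- r) c i *: F i) = \sum_(i <- r) c i *: dia lam h (F i).
Proof.
rewrite (big_morph (dia lam h) (fun _ _ => diaDr _ _ _ _) (dia0r _ _)).
by apply: eq_bigr => i _; rewrite diaZr.
Qed.

(** As [nf] turns concatenation into [dia] and [P] into [mP], each layer of a context with one star
    acts linearly on what fills the star, and so preserves a vanishing sum. *)
Lemma nf_subst f u : starcount u = 1%N ->
  \sum_(e <- f) e.1 *: nf lam e.2 = 0 ->
  \sum_(e <- f) e.1 *: nf lam (subst e.2 u) = 0.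
Proof.
move=> cu f0; move: u cu; apply: (@word_mut (option X)
  (fun u => starcount u = 1%N -> \sum_(e <- f) e.1 *: nf lam (subst e.2 u) = 0)
  (fun l => lstarcount l = 1%N -> \sum_(e <- f) e.1 *: nf lam (lsubst e.2 l) = 0)).
- by [].
- move=> l IHl v IHv /= /addn_eq1[[/IHl h1 h0]|[h0 /IHv h1]].
    (* The starless factor does not depend on the word substituted, so the first word [e0.2] of [f]
       represents it in all terms; an empty [f] has no such word and is treated apart. *)
    case: f {f0 IHl IHv} h1 => [|e0 f] h1; first by rewrite big_nil.
    rewrite (eq_bigr (fun e => e.1 *: dia lam (nf lam (lsubst e.2 l))
                                           (nf lam (subst e0.2 v)))).
      by rewrite -dia_suml h1 dia0l.
    by move=> e _; rewrite nf_cat (subst_nostar e.2 e0.2 h0).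
  case: f {f0 IHl IHv} h1 => [|e0 f] h1; first by rewrite big_nil.
  rewrite (eq_bigr (fun e => e.1 *: dia lam (nf lam (lsubst e0.2 l))
                                         (nf lam (subst e.2 v)))).
    by rewrite -dia_sumr h1 dia0r.
  by move=> e _; rewrite nf_cat (lsubst_nostar e.2 e0.2 h0).
- by case.
- by move=> w IH /= /IH h; rewrite -mP_sum h mP0.
Qed.

(** Under [nf] the relation becomes [rota_baxter] for [nf x] and [nf y]. *)
Lemma nf_sRB x y : \sum_(e <- sRB lam x y) e.1 *: nf lam e.2 = 0.
Proof.
rewrite /sRB !big_cons big_nil /= -!/(pw _) !nf_cat /= rota_baxter !mPD mPZ.
by rewrite scale1r !scaleN1r scaleNr addr0 -!opprD [X in _ - X]addrCA !addrA subrr.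
Qed.

Lemma lnform_opoly f : lnform (opoly_malg f) = \sum_(e <- f) e.1 *: nf lam e.2.
Proof.
rewrite /lnform /opoly_malg linear_sum; apply: eq_bigr => e _.
by rewrite linearZ /= mlinU.
Qed.

Lemma lnform_Id m : inIdM m -> lnform m = 0.
Proof.
move=> [l [hl ->]]; rewrite /lnform linear_sum big_seq big1 // => e /hl ce.
have : lnform (opoly_malg (substp e.2.1 (sRB lam e.2.2.1 e.2.2.2))) = 0.
  by rewrite lnform_opoly /substp big_map; apply: (nf_subst ce (nf_sRB _ _)).
by move: (opoly_malg _) => m' e0; rewrite linearZ /= -/lnform e0 scaler0.
Qed.

(** [lnform] vanishes on the ideal, yet returns a combination of good words unchanged. *)
Lemma good_independent g :
  (forall e, e \in g -> wgood e.2) -> inIdM (opoly_malg g) -> opoly_malg g = 0.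
Proof.
move=> gg /lnform_Id; rewrite lnform_opoly => <-.
by rewrite /opoly_malg; apply: eq_big_seq => e /gg ge; rewrite nf_good.
Qed.

End Ideal.

Theorem theorem4p3 (d : Order.disp_t) (X : orderType d) (K : comNzRingType) (lam : K)
  (wfX : well_founded (fun x y : X => (x < y)%O)) :
  (* Irr(S) = Phi(X) *)
  (forall w : word X, Irr lam w <-> Phi w) /\
  (* Phi(X) spans K<X;P>/Id(S) *)
  (forall f : opoly K X, exists g : opoly K X,
      (forall e, e \in g -> Phi e.2) /\ inId lam (psub f g)) /\
  (* Phi(X) is linearly independent modulo Id(S) *)
  (forall g : opoly K X, (forall e, e \in g -> Phi e.2) ->
      inId lam g -> forall w, ocoef g w = 0).
Proof.
split; first by move=> w; rewrite Irr_good Phi_good.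
split=> [f|g Pg /inIdE Ig w].
  have [g [Pg Ig]] := span_opoly lam f; exists g; split.
    by move=> e /Pg; rewrite Phi_good.
  by apply/inIdE; rewrite opoly_malg_psub.
rewrite -mcoeff_opoly (good_independent _ Ig) ?mcoeff0 //.
by move=> e /Pg /Phi_good.
Qed.
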